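(* Let $0<p<\infty$, and let $u,v,w$ be weights on $(0,\infty)$. Then the inequality $$\operatorname*{ess\,sup}_{x\in(0,\infty)}w(x)\,\frac1{U(x)}\int_0^xf(t)u(t)\,dt\le c\left(\int_0^\infty f(x)^pv(x)\,dx\right)^{\frac1p}\qquad(1)$$ holds for every non-negative non-increasing measurable function $f$ on $(0,\infty)$ (with a finite constant $c$ independent of $f$) if and only if the inequality $$\operatorname*{ess\,sup}_{x\in(0,\infty)}w(x)^p\left(\frac1{U(x)}\int_0^x\left(\int_t^\infty h(s)\,ds\right)^{\frac1p}u(t)\,dt\right)^p\le C\int_0^\infty h(t)V(t)\,dt\qquad(2)$$ holds for all non-negative measurable functions $h$ on $(0,\infty)$ (with a finite constant $C$ independent of $h$). Moreover, the best constants $c$ and $C$ in (1) and (2), respectively, satisfy $C\approx c^p$.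
   Context: A weight is a locally integrable non-negative function on $(0,\infty)$. $U(t)=\int_0^tu(s)\,ds$ and $V(t)=\int_0^tv(s)\,ds$; it is assumed that $U(t)>0$ for every $t\in(0,\infty)$. Conventions: $1/\infty=0$, $1/0=\infty$, $0/0=0$, $\infty/\infty=0$, $0\cdot\infty=0$. $a\approx b$ means $\lambda^{-1}a\le b\le\lambda a$ with $\lambda>0$ depending only on inessential parameters (such as the exponent). *)

(* Defs.v *)
From HB Require Import structures.
From mathcomp Require Import all_boot all_order all_algebra.
From mathcomp Require Import all_classical all_reals all_analysis ess_sup_inf.

Set Implicit Arguments.
Unset Strict Implicit.
Unset Printing Implicit Defensive.

Import Order.TTheory GRing.Theory Num.Theory.
Import numFieldNormedType.Exports.

Local Open Scope classical_set_scope.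
Local Open Scope ring_scope.
Local Open Scope ereal_scope.

(* Functions on (0, +oo) are total functions R -> R of which only the values
   on `]0, +oo[ matter.  The conventions 1/oo = 0, 1/0 = oo, 0/0 = oo/oo = 0
   and 0 * oo = 0 are those of inve and mule on \bar R. *)

Definition halfline {R : realType} : set R := `]0%R, +oo[.

Lemma measurable_halfline {R : realType} : measurable (@halfline R).
Proof. exact: measurable_itv. Qed.

Definition weight {R : realType} (w : R -> R) : Prop :=
  locally_integrable halfline w /\ {in halfline, forall x, (0 <= w x)%R}.

Definition nonneg_measurable {R : realType} (h : R -> R) : Prop :=
  measurable_fun halfline h /\ {in halfline, forall x, (0 <= h x)%R}.

Definition nonincreasing_on_halfline {R : realType} (f : R -> R) : Prop :=
  {in halfline &, forall x y, (x <= y)%R -> (f y <= f x)%R}.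

(* The value may be +oo, since u need not be integrable near 0. *)
Definition primitive {R : realType} (u : R -> R) (t : R) : \bar R :=
  \int[lebesgue_measure]_(s in `]0%R, t[) (u s)%:E.

Definition ess_sup_halfline {R : realType} (g : R -> \bar R) : \bar R :=
  ess_sup (mrestr (@lebesgue_measure R) measurable_halfline) g.

Definition monotone_ineq {R : realType} (p : R) (u v w : R -> R) (c : R)
    (f : R -> R) : Prop :=
  ess_sup_halfline (fun x => (w x)%:E * ((primitive u x)^-1 *
    \int[lebesgue_measure]_(t in `]0%R, x[) (f t * u t)%:E))
  <= c%:E * (\int[lebesgue_measure]_(x in halfline)
               (f x `^ p * v x)%:E) `^ p^-1.

Definition reduced_ineq {R : realType} (p : R) (u v w : R -> R) (C : R)
    (h : R -> R) : Prop :=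
  ess_sup_halfline (fun x => (w x `^ p)%:E * ((primitive u x)^-1 *
    \int[lebesgue_measure]_(t in `]0%R, x[)
      ((\int[lebesgue_measure]_(s in `]t, +oo[) (h s)%:E) `^ p^-1
       * (u t)%:E)) `^ p)
  <= C%:E * \int[lebesgue_measure]_(t in halfline)
              ((h t)%:E * primitive v t).

Definition monotone_constants {R : realType} (p : R) (u v w : R -> R) :
    set R :=
  [set c | (0 <= c)%R /\ forall f, nonneg_measurable f ->
     nonincreasing_on_halfline f -> monotone_ineq p u v w c f].

Definition reduced_constants {R : realType} (p : R) (u v w : R -> R) :
    set R :=
  [set C | (0 <= C)%R /\ forall h, nonneg_measurable h ->
     reduced_ineq p u v w C h].

(* Infimum of a set of admissible constants; +oo when none is admissible. *)
Definition best_constant {R : realType} (A : set R) : \bar R :=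
  ereal_inf [set c%:E | c in A].

(* Main.v *)
Require Import Defs.
From mathcomp Require Import all_boot all_order all_algebra.
From mathcomp Require Import all_classical all_reals all_analysis ess_sup_inf.
From mathcomp Require Import measurable_realfun lra.
Import Order.TTheory GRing.Theory Num.Theory.
Import numFieldNormedType.Exports.

Local Open Scope classical_set_scope.
Local Open Scope ring_scope.
Local Open Scope ereal_scope.

(**
  Write [H t] for the tail integral of [h] over ]t, oo[.  By Tonelli,
  [int H v = int h V], so inequality (2) for [h] is the [p]-th power of
  inequality (1) for [f = H^(1/p)].  Hence (1) gives (2) with [C = c^p]; if [H]
  takes the value +oo, truncate [h] and pass to the limit.
  Conversely, given a nonincreasing [f], truncate [phi = f^p] to an integrable
  nonincreasing [psi] and take [h s = n (psi s - psi (s + 1/n))] >= 0.  Its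
  tail is the average of [psi] over ]t, t + 1/n], which is at most [psi t] and
  converges to it almost everywhere by Lebesgue differentiation.  Since the left
  side of (1) is lower semicontinuous under a.e. convergence (Fatou), (2) gives
  (1) with [c = C^(1/p)].  So [C = c^p] for the best constants, and
  [lambda = 1] works.
*)

(** * Powers and limits inferior in the extended reals *)

Lemma lee_poweR_inv (R : realType) (p : R) (a b : \bar R) :
  (0 < p)%R -> 0 <= a -> 0 <= b -> (a `^ p <= b) = (a <= b `^ p^-1).
Proof.
move=> p0 a0 b0; have pN0 : p != 0%R by rewrite gt_eqF.
have inE0y (x : \bar R) : 0 <= x -> x \in `[0, +oo].
  by move=> x0; rewrite in_itv/= x0 leey.
apply/idP/idP => h.
- rewrite -(poweRe1 a0) -(mulfV pN0) poweRrM.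
  apply: gt0_ler_poweR => //; rewrite ?inE0y ?poweR_ge0//.
  by rewrite invr_ge0 ltW.
- rewrite -(poweRe1 b0) -(mulVf pN0) poweRrM.
  by apply: gt0_ler_poweR => //; rewrite ?inE0y ?poweR_ge0// ltW.
Qed.

Lemma limn_einf_geW (R : realType) (u : (\bar R)^nat) (y : \bar R) :
  (\forall n \near \oo, y <= u n) -> y <= limn_einf u.
Proof.
move=> [N _ yu]; rewrite limn_einf_lim.
apply: lime_ge; first exact: is_cvg_einfs.
exists N => // n /= Nn; apply: le_ereal_inf_tmp => _ [m /= nm <-].
by apply: yu => /=; exact: leq_trans nm.
Qed.

(** If the bound failed, a real [z] would lie strictly between [X^(1/q)] and [l]. Eventually
    [z < a n], so [z^q] would be a lower bound of the limit inferior [X], a contradiction. Working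
    with a real [z] covers [l = +oo] as well. *)
Lemma poweR_le_limn_einf (R : realType) (q : R) (a : (\bar R)^nat) (l : \bar R) :
  (0 < q)%R -> (forall n, 0 <= a n) -> a n @[n --> \oo] --> l ->
  l `^ q <= limn_einf (fun n => a n `^ q).
Proof.
move=> q0 a0 al; set X := limn_einf _.
have X0 : 0 <= X by apply: limn_einf_geW; apply: nearW => n; exact: poweR_ge0.
have l0 : 0 <= l.
  by rewrite -(cvg_lim _ al)//; apply: lime_ge; [apply/cvg_ex; exists l|exact: nearW].
rewrite lee_poweR_inv// leNgt; apply/negP => Xl.
have [z /andP[Xz zl]] : exists z : R, X `^ q^-1 < z%:E < l.
  have := poweR_ge0 X q^-1; move: Xl; case: (X `^ q^-1) =>
    [b bl _|bl _|//]; last by rewrite ltNge leey in bl.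
  case: l bl {al l0} => [l|_|//].
  - rewrite lte_fin => bl; exists ((b + l) / 2)%R.
    by rewrite !lte_fin midf_lt//= midf_lt.
  - by exists (b + 1)%R; rewrite lte_fin ltrDl ltr01 ltry.
have z0 : 0 <= z%:E by apply: le_trans (ltW Xz); exact: poweR_ge0.
move: Xz; rewrite ltNge -lee_poweR_inv// => /negP; apply.
apply: limn_einf_geW.
have : \forall n \near \oo, z%:E < a n.
  by apply: (al [set y | z%:E < y]); exact: (open_ereal_gt' zl).
apply: filterS => n zan; rewrite gt0_ler_poweR ?(ltW q0)//.
- by rewrite in_itv/= z0 leey.
- by rewrite in_itv/= a0 leey.
- exact: ltW.
Qed.

(** * Tail integrals and Tonelli's theorem *)

Section tails.
Context {R : realType}.
Local Notation mu := (@lebesgue_measure R).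

Definition tail (h : R -> R) (t : R) : \bar R :=
  \int[mu]_(s in `]t, +oo[) (h s)%:E.

Lemma tail_ge0 (h : R -> R) (t : R) : nonneg_measurable h -> (0 < t)%R ->
  0 <= tail h t.
Proof.
move=> [_ h0] t0; apply: integral_ge0 => s /=; rewrite in_itv/= andbT => ts.
by rewrite lee_fin h0// inE /halfline/= in_itv/= (lt_trans t0).
Qed.

Lemma measurable_halfline_restrict (h : R -> R) :
  measurable_fun halfline h -> measurable_fun setT (h \_ halfline).
Proof.
by move=> mh; apply/(measurable_restrictT _ _).1 => //; exact: measurable_halfline.
Qed.

(** The kernel [v(t) h(s)] on [0 < t < s], extended by zero so that Tonelli's theorem applies on the
    whole plane. *)
Let F (h v : R -> R) (z : measurableTypeR R * measurableTypeR R) : \bar R :=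
  ((v \_ halfline) z.1 * (h \_ halfline) z.2 *
     \1_[set y : R * R | (y.1 < y.2)%R] z)%:E.

Let measurable_F (h v : R -> R) :
  measurable_fun halfline h -> measurable_fun halfline v ->
  measurable_fun setT (F h v).
Proof.
move=> mh mv; apply/measurable_EFinP; apply: measurable_funM.
  apply: measurable_funM.
  - by apply: measurableT_comp => //; exact: measurable_halfline_restrict.
  - by apply: measurableT_comp => //; exact: measurable_halfline_restrict.
apply: measurable_indic; rewrite -[X in measurable X]setTI.
exact: (measurable_fun_ltr measurable_fst measurable_snd measurableT).
Qed.

Let restrict_ge0 (h : R -> R) : {in halfline, forall x, (0 <= h x)%R} ->
  forall x, (0 <= (h \_ halfline) x)%R.
Proof. by move=> h0 x; rewrite patchE; case: ifPn => // /h0. Qed.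

Let F_ge0 h v : {in halfline, forall x, (0 <= h x)%R} ->
  {in halfline, forall x, (0 <= v x)%R} -> forall z, 0 <= F h v z.
Proof.
by move=> h0 v0 z; rewrite lee_fin !mulr_ge0// restrict_ge0.
Qed.

Let integral_F_snd h v t : nonneg_measurable h ->
  {in halfline, forall x, (0 <= v x)%R} ->
  \int[mu]_s F h v (t, s) =
  ((fun t => tail h t * (v t)%:E) \_ halfline) t.
Proof.
move=> [mh h0] v0; rewrite patchE; case: ifPn => [tpos|tN]; last first.
  rewrite [RHS](_ : _ = 0)//; apply: integral0_eq => s _.
  by rewrite /F/= patchE (negbTE tN) !mul0r.
have sub : `]t, +oo[%classic `<=` @halfline R.
  move: tpos; rewrite inE /halfline/= in_itv/= andbT => t0 s; rewrite /halfline/=.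
  by rewrite !in_itv/= !andbT; exact: lt_trans.
rewrite muleC /tail -ge0_integralZl_EFin//; last 3 first.
- by move=> s ts; rewrite lee_fin h0// inE; exact: sub.
- by apply/measurable_EFinP; exact: (measurable_funS measurable_halfline sub mh).
- exact: v0.
rewrite [RHS]integral_mkcond; apply: eq_integral => s _.
rewrite /F/= !patchE tpos indicE -EFinM.
have [ts|ts] := boolP (s \in `]t, +oo[%classic).
  move: ts; rewrite inE => ts; rewrite mem_set; last exact: sub.
  by rewrite mem_set ?mulr1//=; move: ts; rewrite /= in_itv/= andbT.
rewrite [X in (_ * (nat_of_bool X)%:R)%R]memNset ?mulr0//= => ts'; move/negP: ts; apply.
by rewrite inE/= in_itv/= andbT.
Qed.

Let integral_F_fst h v s : {in halfline, forall x, (0 <= h x)%R} ->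
  nonneg_measurable v ->
  \int[mu]_t F h v (t, s) =
  ((fun s => (h s)%:E * primitive v s) \_ halfline) s.
Proof.
move=> h0 [mv v0]; rewrite patchE; case: ifPn => [spos|sN]; last first.
  rewrite [RHS](_ : _ = 0)//; apply: integral0_eq => t _.
  by rewrite /F/= [X in (_ * X * _)%R]patchE (negbTE sN) mulr0 mul0r.
have sub : `]0%R, s[%classic `<=` @halfline R.
  by move=> t; rewrite /halfline/= !in_itv/= andbT => /andP[].
rewrite /primitive -ge0_integralZl_EFin//; last 3 first.
- by move=> t ts; rewrite lee_fin v0// inE; exact: sub.
- by apply/measurable_EFinP; exact: (measurable_funS measurable_halfline sub mv).
- exact: h0.
rewrite [RHS]integral_mkcond; apply: eq_integral => t _.
rewrite /F/= !patchE spos indicE -EFinM.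
have [ts|ts] := boolP (t \in `]0%R, s[%classic).
  move: ts; rewrite inE => ts; rewrite mem_set; last exact: sub.
  rewrite mem_set ?mulr1 1?mulrC//=.
  by move: ts; rewrite /= in_itv/= => /andP[].
case: ifPn => tpos; last by rewrite !mul0r.
rewrite [X in (_ * (nat_of_bool X)%:R)%R]memNset ?mulr0//= => ts'; move/negP: ts; apply.
move: tpos; rewrite !inE /halfline/= !in_itv/= andbT => t0.
by rewrite t0.
Qed.

Lemma tail_fubini (h v : R -> R) :
  nonneg_measurable h -> nonneg_measurable v ->
  \int[mu]_(t in halfline) (tail h t * (v t)%:E) =
  \int[mu]_(s in halfline) ((h s)%:E * primitive v s).
Proof.
move=> mh mv; have [[mh1 h0] [mv1 v0]] := (mh, mv).
rewrite integral_mkcond [RHS]integral_mkcond.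
(* Both sides become iterated integrals of [F], in opposite orders. *)
under eq_integral do rewrite -(integral_F_snd _ _ _ mh v0).
under [RHS]eq_integral do rewrite -(integral_F_fst _ _ _ h0 mv).
by apply: (fubini_tonelli (F h v)); [exact: measurable_F|exact: F_ge0].
Qed.

Lemma measurable_tail (h : R -> R) : nonneg_measurable h ->
  measurable_fun halfline (tail h).
Proof.
move=> mh; apply/(measurable_restrictT _ _).2; first exact: measurable_halfline.
(* With [v = 1] the inner integral of [F] is the zero-extended tail, so its measurability is part of
   Tonelli's theorem. *)
rewrite [X in measurable_fun _ X](_ : _ = fun t => \int[mu]_s F h (cst 1%R) (t, s)).
  apply: (measurable_fun_fubini_tonelli_F (F h (cst 1%R))).
  - by apply: measurable_F => //; case: mh.
  - by apply: F_ge0; case: mh => // _ _ x _; exact: ler01.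
apply/funext => t; rewrite integral_F_snd//.
rewrite !patchE.
by case: ifPn => // _; rewrite /= mule1.
Qed.

End tails.

(** * Translation invariance of Lebesgue measure *)

Section translation.
Context {R : realType}.
Local Notation mu := (@lebesgue_measure R).

(** Uniqueness of Lebesgue measure: translation preserves the length of each []a, b]], and these
    intervals determine the measure. *)
Lemma lebesgue_measure_shift (d : R) (A : set R) : measurable A ->
  pushforward mu ((fun x => x + d)%R : _ -> measurableTypeR R) A = mu A.
Proof.
move=> mA; apply/esym/lebesgue_measure_unique => //=
  [|mshift _ [[a b]] _ <-]; first exact: measurable_funD.
rewrite /pushforward/= (_ : _ @^-1` _ = `](a - d)%R, (b - d)%R]%classic).
  rewrite !lebesgue_measure_itv/= !lte_fin ltrD2r; case: ifPn => // _.
  by congr EFin; lra.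
by apply/seteqP; split => x /=; rewrite !in_itv/=; lra.
Qed.

Lemma tail_shift (d : R) (h : R -> R) (t : R) : (forall x, 0 <= h x)%R ->
  measurable_fun setT h ->
  tail (fun x => h (x + d)%R) t = tail h (t + d)%R.
Proof.
move=> h0 mh; rewrite /tail (_ : `]t, +oo[%classic =
    ((fun x => x + d)%R : _ -> measurableTypeR R) @^-1` `](t + d)%R, +oo[); last first.
  by apply/seteqP; split => x /=; rewrite !in_itv/= !andbT ltrD2r.
have mshift : measurable_fun setT
    ((fun x => x + d)%R : measurableTypeR R -> measurableTypeR R).
  exact: measurable_funD.
rewrite -(@ge0_integral_pushforward _ _ _ _ _ _ mshift mu _ (EFin \o h))//=.
- by apply: eq_measure_integral => //= A mA _; exact: lebesgue_measure_shift.
- by apply/measurable_EFinP; exact: measurable_funTS.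
- by move=> x _; rewrite lee_fin.
Qed.

End translation.

(** * Stability of the Hardy-type inequality under almost everywhere limits *)

Section hardy_functional.
Context {R : realType}.
Local Notation mu := (@lebesgue_measure R).

Lemma limn_einf_leW (u : (\bar R)^nat) (y : \bar R) :
  (forall n, u n <= y) -> limn_einf u <= y.
Proof.
move=> uy; rewrite limn_einf_lim; apply: lime_le; first exact: is_cvg_einfs.
apply: nearW => n; apply: le_trans (uy n).
by apply: ereal_inf_lbound; exists n => /=.
Qed.

(** The factor [c] is absorbed into the power as [(c^(1/q))^q], which also covers [c = 0] with
    [l = +oo]. *)
Lemma poweRM_le_limn_einf (q c : R) (a : (\bar R)^nat) (l : \bar R) :
  (0 < q)%R -> (0 <= c)%R -> (forall n, 0 <= a n) -> a n @[n --> \oo] --> l ->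
  l `^ q * c%:E <= limn_einf (fun n => a n `^ q * c%:E).
Proof.
move=> q0 c0 a0 al.
have cE : c%:E = (c `^ q^-1)%:E `^ q.
  by rewrite poweR_EFin -powRrM mulVf ?gt_eqF// powRr1.
have cq0 : 0 <= (c `^ q^-1)%:E by rewrite lee_fin powR_ge0.
have l0 : 0 <= l.
  by rewrite -(cvg_lim _ al)//; apply: lime_ge; [apply/cvg_ex; exists l|exact: nearW].
rewrite cE -poweRM//; under eq_fun do rewrite -poweRM//.
apply: poweR_le_limn_einf => // [n|]; first exact: mule_ge0.
exact: cvgeZr.
Qed.

(* Inequality (1) for [f = g^(1/p)], with [L] as its right-hand side. *)
Definition hardy_le (p : R) (u w : R -> R) (g : R -> \bar R) (L : \bar R) :=
  \forall x \ae mrestr mu measurable_halfline,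
    (w x)%:E * ((primitive u x)^-1 *
      \int[mu]_(t in `]0%R, x[) (g t `^ p^-1 * (u t)%:E)) <= L.

Lemma ae_halfline : \forall x \ae mrestr mu measurable_halfline, halfline x.
Proof.
exists (~` halfline); split.
- by apply: measurableC; exact: measurable_halfline.
- by rewrite /mrestr setICl measure0.
- exact: subset_refl.
Qed.

Lemma subset_itvoo_halfline (x : R) : `]0%R, x[ `<=` @halfline R.
Proof. by move=> t; rewrite /halfline/= !in_itv/= andbT => /andP[]. Qed.

(** Fatou's lemma makes the integrals on the left lower semicontinuous. The bound [L] is common to
    all [n], so right-hand sides have to be made free of [n] beforehand. *)
Lemma hardy_le_closed (p : R) (u w : R -> R) (gn : (R -> \bar R)^nat)
    (g : R -> \bar R) (L : \bar R) :
  (0 < p)%R -> weight u -> weight w ->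
  {in halfline, forall t, 0 < primitive u t} ->
  (forall n, measurable_fun halfline (gn n)) ->
  (forall n t, halfline t -> 0 <= gn n t) ->
  measurable_fun halfline g ->
  {ae mu, forall t, halfline t -> gn n t @[n --> \oo] --> g t} ->
  (forall n, hardy_le p u w (gn n) L) -> hardy_le p u w g L.
Proof.
move=> p0 [[mu_u _ _] u0] [_ w0] U0 mgn gn0 mg gng hL.
have ip0 : (0 < p^-1)%R by rewrite invr_gt0.
have meas (f : R -> \bar R) (x : R) : measurable_fun halfline f ->
    measurable_fun `]0%R, x[ (fun t => f t `^ p^-1 * (u t)%:E).
  move=> mf; apply: emeasurable_funM.
    exact: (measurableT_comp (@measurable_poweR R p^-1) (measurable_funS
      measurable_halfline (@subset_itvoo_halfline x) mf)).
  apply/measurable_EFinP.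
  exact: (measurable_funS measurable_halfline (@subset_itvoo_halfline x) mu_u).
have term_ge0 (f : R -> \bar R) (x t : R) : `]0%R, x[%classic t ->
    0 <= f t `^ p^-1 * (u t)%:E.
  move=> /subset_itvoo_halfline t0; apply: mule_ge0; first exact: poweR_ge0.
  by rewrite lee_fin u0// inE.
(* First the integrand is bounded almost everywhere by the limit inferior of the integrands, then
   Fatou's lemma moves that limit out of the integral. *)
have intg x : \int[mu]_(t in `]0%R, x[) (g t `^ p^-1 * (u t)%:E) <=
    limn_einf (fun n => \int[mu]_(t in `]0%R, x[) (gn n t `^ p^-1 * (u t)%:E)).
  apply: le_trans; last first.
    apply: (fatou mu _ (f := fun n t => gn n t `^ p^-1 * (u t)%:E)) => //.
    - by move=> n; exact: meas.
    - by move=> n t; exact: term_ge0.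
  apply: ae_ge0_le_integral => //.
  - by move=> t; exact: term_ge0.
  - exact: meas.
  - move=> t xt; apply: limn_einf_geW; apply: nearW => n; exact: term_ge0 xt.
  (* The limit inferior is measurable as minus the limit superior of the negatives. *)
  - rewrite [X in measurable_fun _ X](_ : _ = fun t =>
        - limn_esup (fun n => - (gn n t `^ p^-1 * (u t)%:E))); last first.
      by apply/funext => t; rewrite -limn_einfN; congr limn_einf;
        apply/funext => n /=; rewrite oppeK.
    apply: measurableT_comp => //; apply: measurable_fun_limn_esup => n.
    by apply: measurableT_comp => //; exact: meas.
  - apply: filterS gng; first exact: (ae_filter_ringOfSetsType mu).
    move=> t tcvg /subset_itvoo_halfline t0.
    apply: poweRM_le_limn_einf => //; first by rewrite u0 ?inE.
    + by move=> n; exact: gn0.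
    + exact: tcvg.
(* The exceptional sets for all [n] form a countable union of null sets. *)
have hLx : \forall x \ae mrestr mu measurable_halfline, forall n,
    (w x)%:E * ((primitive u x)^-1 *
      \int[mu]_(t in `]0%R, x[) (gn n t `^ p^-1 * (u t)%:E)) <= L.
  by apply/ae_foralln => n; exact: hL.
apply: filterS2 ae_halfline hLx.
  exact: (ae_filter_ringOfSetsType (mrestr mu measurable_halfline)).
move=> x xpos hLx.
(* The factor [w(x)/U(x)] is a finite real because [U(x) > 0]; when [U(x) = +oo] it is 0 by
   convention. *)
have [k k0 kE] : exists2 k : R, (0 <= k)%R &
    (w x)%:E * (primitive u x)^-1 = k%:E.
  have := U0 x; rewrite inE => /(_ xpos); case: (primitive u x) => [r|_|//].
  - rewrite lte_fin => r0; exists (w x / r)%R; last by rewrite inver gt_eqF.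
    by rewrite divr_ge0 ?w0 ?inE// ltW.
  - by exists 0%R => //; rewrite invey mule0.
(* For [k = 0] the claim is [0 <= L], which the bound at [n = 0] gives; for [k > 0] one divides by
   [k]. *)
rewrite muleA kE; move: k0 kE; rewrite le_eqVlt => /predU1P[<- kE|k0 kE].
  by rewrite mul0e; have := hLx 0%N; rewrite muleA kE mul0e.
rewrite -lee_pdivlMl//; apply: le_trans (intg x) _.
by apply: limn_einf_leW => n; rewrite lee_pdivlMl// -kE -muleA.
Qed.

End hardy_functional.

(** * Truncation in height and support *)

Section truncation.
Context {R : realType}.
Local Notation mu := (@lebesgue_measure R).

(** Cutting both height and support makes the function integrable. The support is cut only on the
    right of the half-line, so a non-negative nonincreasing function stays nonincreasing there. *)
Definition trunc (n : nat) (h : R -> R) : R -> R :=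
  (fun s => Num.min (h s) n%:R) \_ `]0%R, n%:R[.

Lemma trunc_ge0 (n : nat) (h : R -> R) : nonneg_measurable h ->
  forall s, (0 <= trunc n h s)%R.
Proof.
move=> [_ h0] s; rewrite /trunc patchE; case: ifPn => // /[!inE].
by move=> /subset_itvoo_halfline s0; rewrite le_min ler0n h0 ?inE.
Qed.

Lemma trunc_le (n : nat) (h : R -> R) (s : R) : nonneg_measurable h ->
  halfline s -> (trunc n h s <= h s)%R.
Proof.
move=> [_ h0] s0; rewrite /trunc patchE; case: ifPn => _; last by rewrite h0 ?inE.
by rewrite ge_min lexx.
Qed.

Lemma integrable_trunc (n : nat) (h : R -> R) : nonneg_measurable h ->
  mu.-integrable setT (EFin \o trunc n h).
Proof.
move=> [mh h0]; rewrite /trunc -restrict_EFin; apply: (integrable_mkcond _ _).1 => //.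
apply: measurable_bounded_integrable => //.
- by rewrite /= lebesgue_measure_itv/=; case: ifPn => _; rewrite -?EFinD ltry.
- apply: measurable_minr => //.
  exact: (measurable_funS measurable_halfline (@subset_itvoo_halfline _ _) mh).
- exists n%:R; split; first exact: num_real.
  move=> M nM s /subset_itvoo_halfline s0.
  rewrite /= ger0_norm; last by rewrite le_min ler0n h0 ?inE.
  by apply: le_trans (ltW nM); rewrite ge_min lexx orbT.
Qed.

Lemma measurable_trunc (n : nat) (h : R -> R) : nonneg_measurable h ->
  measurable_fun setT (trunc n h).
Proof.
by move=> /(integrable_trunc n) /integrableP[/measurable_EFinP].
Qed.

Lemma nonneg_measurable_trunc (n : nat) (h : R -> R) : nonneg_measurable h ->
  nonneg_measurable (trunc n h).
Proof.
move=> hh; split; last by move=> s _; exact: trunc_ge0.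
by apply: measurable_funTS; exact: measurable_trunc.
Qed.

Lemma trunc_nd (h : R -> R) (s : R) : nonneg_measurable h -> halfline s ->
  {homo (fun n => trunc n h s) : m n / (m <= n)%N >-> (m <= n)%R}.
Proof.
move=> hh s0 m n mn; rewrite [leLHS]/trunc patchE.
case: ifPn => [/[!inE] sm|_]; last exact: trunc_ge0.
rewrite /trunc patchE mem_set; first by rewrite le_min !ge_min lexx ler_nat mn orbT.
move: sm; rewrite /= !in_itv/= => /andP[-> sm]/=.
by rewrite (lt_le_trans sm)// ler_nat.
Qed.

Lemma trunc_cvg (h : R -> R) (s : R) : halfline s ->
  trunc n h s @[n --> \oo] --> h s.
Proof.
rewrite /halfline/= in_itv/= andbT => s0; apply: cvg_near_cst.
near=> n; rewrite /trunc patchE mem_set/=.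
  apply/min_idPl; near: n; exact: nbhs_infty_ger.
by rewrite in_itv/= s0/=; near: n; exact: nbhs_infty_gtr.
Unshelve. all: by end_near. Qed.

Lemma itvoy_halfline (t : R) : halfline t -> `]t, +oo[ `<=` @halfline R.
Proof.
rewrite /halfline/= in_itv/= andbT => t0 s/=; rewrite !in_itv/= !andbT.
exact: lt_trans.
Qed.

(** Monotone convergence; the limit may be [+oo], although every truncated tail is finite. *)
Lemma tail_trunc_cvg (h : R -> R) (t : R) : nonneg_measurable h -> halfline t ->
  tail (trunc n h) t @[n --> \oo] --> tail h t.
Proof.
move=> hh t0; rewrite /tail.
rewrite (_ : \int[mu]_(s in `]t, +oo[) (h s)%:E =
    \int[mu]_(s in `]t, +oo[) limn (fun n => (trunc n h s)%:E)); last first.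
  apply: eq_integral => s; rewrite inE => ts; apply/esym/cvg_lim => //.
  by apply: cvg_EFin; [exact: nearW|apply: trunc_cvg; exact: itvoy_halfline ts].
apply: (@cvg_monotone_convergence _ _ _ mu _ _ (fun n s => (trunc n h s)%:E)) => //.
- by move=> n; apply/measurable_EFinP/measurable_funTS; exact: measurable_trunc.
- by move=> n s _; rewrite lee_fin trunc_ge0.
- move=> s ts m n mn; rewrite lee_fin; apply: trunc_nd => //.
  exact: itvoy_halfline ts.
Qed.

Lemma tail_trunc_fin_num (n : nat) (h : R -> R) (t : R) : nonneg_measurable h ->
  tail (trunc n h) t \is a fin_num.
Proof.
move=> hh; apply: integrable_fin_num => //.
by apply: (integrableS measurableT) => //; exact: integrable_trunc.
Qed.

End truncation.

(** * Right averages of an integrable nonincreasing function *)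

Section average.
Context {R : realType}.
Local Notation mu := (@lebesgue_measure R).

Variable psi : R -> R.
Hypothesis psi0 : forall s, (0 <= psi s)%R.
Hypothesis ipsi : mu.-integrable setT (EFin \o psi).
Hypothesis ni_psi : nonincreasing_on_halfline psi.

(** Minus the difference quotient of [psi] with step [1/(n+1)]; the shifted index keeps the step
    defined at [n = 0]. *)
Definition steep (n : nat) (s : R) : R :=
  (n.+1%:R * (psi s - psi (s + n.+1%:R^-1)))%R.

Let measurable_psi : measurable_fun setT psi.
Proof. by move/integrableP : ipsi => [/measurable_EFinP]. Qed.

Let measurable_psi_shift (d : R) :
  measurable_fun setT (fun s : R => psi (s + d)%R).
Proof.
by apply: (measurableT_comp measurable_psi); exact: measurable_funD.
Qed.

Lemma nonneg_measurable_steep (n : nat) : nonneg_measurable (steep n).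
Proof.
split.
  apply: measurable_funM => //; apply: measurable_funB => //.
    exact: measurable_funTS.
  by apply: measurable_funTS; exact: measurable_psi_shift.
move=> s /[dup] s0; rewrite inE /halfline/= in_itv/= andbT => s_gt0.
rewrite mulr_ge0// subr_ge0 ni_psi// ?lerDl ?invr_ge0//.
by rewrite inE /halfline/= in_itv/= andbT addr_gt0// invr_gt0 ltr0n.
Qed.

(** The base point [-oo] suits the form of Lebesgue differentiation applied below; only differences
    of [Psi] enter the tails. *)
Let Psi (y : R) : R := (\int[mu]_(t in `]-oo, y]) psi t)%R.

Let Psi_diff (x y : R) : (x <= y)%R ->
  (Psi y - Psi x = \int[mu]_(t in `]x, y]) psi t)%R.
Proof.
move=> xy; apply: Rintegral_itvB => //.
by apply: (integrableS measurableT) => //.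
Qed.

Let tail_fin (t : R) : tail psi t \is a fin_num.
Proof.
by apply: integrable_fin_num => //; exact: (integrableS measurableT).
Qed.

Let tail_Psi (x y : R) : (fine (tail psi x) - fine (tail psi y) = Psi y - Psi x)%R.
Proof.
have E (z : R) : fine (tail psi z) = (\int[mu]_t psi t - Psi z)%R.
  rewrite /Psi -set_itvNyy Rintegral_itvB//.
  by apply: (integrableS measurableT).
by rewrite !E; lra.
Qed.

(** By translation the tail of the shifted [psi] is [tail psi] at the shifted point. Integrability
    of [psi] allows the subtraction, which leaves the integral over the short interval. *)
Let tail_steep (n : nat) (t : R) :
  tail (steep n) t = (n.+1%:R * (Psi (t + n.+1%:R^-1) - Psi t))%:E.
Proof.
rewrite -tail_Psi EFinM EFinB !fineK// -tail_shift// {1}/tail.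
have ipsi' : mu.-integrable `]t, +oo[ (EFin \o psi).
  exact: (integrableS measurableT).
have ipsis : mu.-integrable `]t, +oo[ (fun s => (psi (s + n.+1%:R^-1))%:E).
  apply/integrableP; split.
    by apply/measurable_EFinP/measurable_funTS; exact: measurable_psi_shift.
  under eq_integral do rewrite gee0_abs ?lee_fin//.
  rewrite -/(tail (fun s => psi (s + n.+1%:R^-1)%R) t) tail_shift//.
  by rewrite ltey_eq tail_fin.
rewrite /tail -integralB_EFin//.
by rewrite -integralZl//; exact: integrableB.
Qed.

Lemma tail_steep_le (n : nat) (t : R) : halfline t ->
  tail (steep n) t <= (psi t)%:E.
Proof.
move=> t0; rewrite tail_steep lee_fin Psi_diff; last by rewrite lerDl invr_ge0.
rewrite mulrC -ler_pdivlMr// mulrC.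
(* Writing [psi t / (n+1)] as the integral of a constant reduces the bound to [psi s <= psi t] for
   [s > t]. *)
have -> : (n.+1%:R^-1 * psi t =
    \int[mu]_(s in `]t, (t + n.+1%:R^-1)%R]) psi t)%R.
  rewrite Rintegral_cst//= lebesgue_measure_itv/= lte_fin ltrDl invr_gt0 ltr0n.
  by rewrite /= addrAC subrr add0r mulrC.
apply: le_Rintegral => //.
- exact: (integrableS measurableT).
- apply: (@measurable_bounded_integrable _ _ _ _ (cst (psi t))) => //.
  + by rewrite /= lebesgue_measure_itv/=; case: ifPn => _; rewrite -?EFinD ltry.
  + by exists (psi t); split=> [|M tM s _]; rewrite ?num_real//= ger0_norm// ltW.
- move=> s; rewrite /= in_itv/= => /andP[ts _].
  apply: ni_psi; rewrite ?inE// ?ltW//; apply: itvoy_halfline t0 _ _.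
  by rewrite /= in_itv/= ts.
Qed.

(** The tails at [t] are difference quotients of [Psi], so they converge to [psi t] wherever [Psi]
    has derivative [psi t], hence almost everywhere. *)
Lemma tail_steep_cvg :
  {ae mu, forall t, tail (steep n) t @[n --> \oo] --> (psi t)%:E}.
Proof.
have locpsi : locally_integrable setT psi.
  by apply: open_integrable_locally => //; exact: openT.
have ipsiNy (y : R) : mu.-integrable `]-oo, y] (EFin \o psi).
  exact: (integrableS measurableT).
have := FTC1Ny ipsiNy locpsi.
apply: filterS; first exact: (ae_filter_ringOfSetsType mu).
move=> t [dt /esym].
rewrite derive1E => ->.
under eq_fun do rewrite tail_steep.
apply: cvg_EFin; first exact: nearW.
(* The steps tend to 0 through nonzero values, as the punctured filter of the derivative demands. *)
have h0 : (n.+1%:R^-1 : R)%R @[n --> \oo] --> (0^')%R.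
  move=> A [e /= e0 eA]; have := @cvg_harmonic R.
  move=> /cvgr0Pnorm_lt/(_ e e0); apply: filterS => n /= ne.
  by apply: eA => //=; rewrite ?sub0r ?normrN// gt_eqF ?invr_gt0.
have := cvg_comp _ _ h0 dt.
apply: cvg_trans; apply: near_eq_cvg; apply: nearW => n /=.
by rewrite invrK [(_%:A)%R]mulr1 [(_ + t)%R]addrC.
Qed.

End average.

(** * Equivalence of the two inequalities *)

Section equivalence.
Context {R : realType}.
Local Notation mu := (@lebesgue_measure R).

Lemma ae_halfline_sub (P Q : R -> Prop) : (forall x, halfline x -> P x -> Q x) ->
  (\forall x \ae mrestr mu measurable_halfline, P x) ->
  \forall x \ae mrestr mu measurable_halfline, Q x.
Proof.
move=> PQ aeP; apply: filterS2 (@ae_halfline R) aeP.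
  exact: (ae_filter_ringOfSetsType (mrestr mu measurable_halfline)).
exact: PQ.
Qed.

Lemma primitive_ge0 (u : R -> R) (x : R) : weight u -> 0 <= primitive u x.
Proof.
move=> [_ u0]; apply: integral_ge0 => t /subset_itvoo_halfline t0.
by rewrite lee_fin u0// inE.
Qed.

Lemma weight_nonneg_measurable (v : R -> R) : weight v -> nonneg_measurable v.
Proof. by move=> [[]]. Qed.

Lemma hardy_leW (p : R) (u w : R -> R) (g : R -> \bar R) (L M : \bar R) :
  L <= M -> hardy_le p u w g L -> hardy_le p u w g M.
Proof.
by move=> LM; apply: ae_halfline_sub => x _ /le_trans; apply.
Qed.

Lemma monotone_ineqE (p c : R) (u v w f : R -> R) : (0 < p)%R ->
  {in halfline, forall x, (0 <= f x)%R} ->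
  monotone_ineq p u v w c f <->
  hardy_le p u w (fun t => (f t `^ p)%:E)
    (c%:E * (\int[mu]_(x in halfline) (f x `^ p * v x)%:E) `^ p^-1).
Proof.
move=> p0 f0.
have E x : \int[mu]_(t in `]0%R, x[) (f t * u t)%:E =
    \int[mu]_(t in `]0%R, x[) ((f t `^ p)%:E `^ p^-1 * (u t)%:E).
  apply: eq_integral => t; rewrite inE => /subset_itvoo_halfline t0.
  by rewrite poweR_EFin -powRrM mulfV ?gt_eqF// powRr1// f0// inE.
split.
- by move=> /ess_supP; apply: ae_halfline_sub => x _; rewrite E.
- by move=> h; apply/ess_supP; move: h; apply: ae_halfline_sub => x _; rewrite E.
Qed.

(** Tonelli turns the integral of [h V] into that of [tail h] times [v]; then [p]-th roots are taken
    at each [x > 0], all quantities being non-negative. *)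
Lemma reduced_ineqE (p C : R) (u v w h : R -> R) : (0 < p)%R -> (0 <= C)%R ->
  weight u -> weight v -> weight w -> nonneg_measurable h ->
  reduced_ineq p u v w C h <->
  hardy_le p u w (tail h)
    ((C%:E * \int[mu]_(t in halfline) (tail h t * (v t)%:E)) `^ p^-1).
Proof.
move=> p0 C0 wu wv ww hh; have [_ u0] := wu; have [_ w0] := ww.
have [_ v0] := wv; rewrite tail_fubini//; last exact: weight_nonneg_measurable.
set K := C%:E * _.
have K0 : 0 <= K.
  apply: mule_ge0; first by rewrite lee_fin.
  apply: integral_ge0 => t t0; apply: mule_ge0; last exact: primitive_ge0.
  by case: hh => _ h0; rewrite lee_fin h0// inE.
have E x : halfline x ->
    ((w x `^ p)%:E * ((primitive u x)^-1 * \int[mu]_(t in `]0%R, x[)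
      (tail h t `^ p^-1 * (u t)%:E)) `^ p <= K) =
    ((w x)%:E * ((primitive u x)^-1 * \int[mu]_(t in `]0%R, x[)
      (tail h t `^ p^-1 * (u t)%:E)) <= K `^ p^-1).
  move=> x0; have wx0 : 0 <= (w x)%:E by rewrite lee_fin w0// inE.
  have I0 : 0 <= (primitive u x)^-1 *
      \int[mu]_(t in `]0%R, x[) (tail h t `^ p^-1 * (u t)%:E).
    apply: mule_ge0; first by rewrite inve_ge0 primitive_ge0.
    apply: integral_ge0 => t /subset_itvoo_halfline t0.
    by apply: mule_ge0; [exact: poweR_ge0|rewrite lee_fin u0// inE].
  by rewrite -poweR_EFin -poweRM// lee_poweR_inv//; exact: mule_ge0.
split.
- by move=> /ess_supP; apply: ae_halfline_sub => x x0; rewrite E.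
- by move=> H; apply/ess_supP; move: H; apply: ae_halfline_sub => x x0; rewrite -E.
Qed.

Lemma le_integral_weight (g1 g2 : R -> \bar R) (v : R -> R) :
  nonneg_measurable v -> measurable_fun halfline g1 ->
  measurable_fun halfline g2 -> (forall t, halfline t -> 0 <= g1 t) ->
  (forall t, halfline t -> g1 t <= g2 t) ->
  \int[mu]_(t in halfline) (g1 t * (v t)%:E) <=
  \int[mu]_(t in halfline) (g2 t * (v t)%:E).
Proof.
move=> [mv v0] mg1 mg2 g10 g12.
have vt0 t : halfline t -> 0 <= (v t)%:E by move=> t0; rewrite lee_fin v0// inE.
have mv' : measurable_fun halfline (EFin \o v) by exact/measurable_EFinP.
apply: ge0_le_integral => //; first exact: measurable_halfline.
- by move=> t t0; rewrite mule_ge0 ?g10 ?vt0.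
- exact: emeasurable_funM.
- exact: emeasurable_funM.
- by move=> t t0; rewrite lee_wpmul2r ?vt0 ?g12.
Qed.

Lemma halflineP (t : R) : halfline t -> (0 < t)%R.
Proof. by rewrite /halfline/= in_itv/= andbT. Qed.

Lemma integral_tail_ge0 (h v : R -> R) :
  nonneg_measurable h -> nonneg_measurable v ->
  0 <= \int[mu]_(t in halfline) (tail h t * (v t)%:E).
Proof.
move=> hh [_ v0]; apply: integral_ge0 => t t0; apply: mule_ge0.
  by apply: tail_ge0 => //; exact: halflineP.
by rewrite lee_fin v0// inE.
Qed.

Lemma monotone_to_reduced (p c : R) (u v w : R -> R) : (0 < p)%R ->
  weight u -> weight v -> weight w ->
  {in halfline, forall t, 0 < primitive u t} ->
  monotone_constants p u v w c -> reduced_constants p u v w (c `^ p)%R.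
Proof.
move=> p0 wu wv ww U0 [c0 hc]; split=> [|h hh]; first exact: powR_ge0.
apply/reduced_ineqE => //; first exact: powR_ge0.
have nv := weight_nonneg_measurable _ wv.
set I := \int[mu]_(t in halfline) (tail h t * (v t)%:E).
have -> : ((c `^ p)%:E * I) `^ p^-1 = c%:E * I `^ p^-1.
  rewrite poweRM ?lee_fin ?powR_ge0 ?integral_tail_ge0//.
  by rewrite poweR_EFin -powRrM mulfV ?gt_eqF// powRr1.
have hn n := nonneg_measurable_trunc n _ hh.
(* [tail h] may be infinite, whereas (1) speaks of real-valued functions; so the tails of
   truncations are treated first. *)
apply: (hardy_le_closed _ _ _ (fun n => tail (trunc n h))) => //.
- by move=> n; exact: measurable_tail.
- by move=> n t /halflineP; exact: tail_ge0.
- exact: measurable_tail.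
- by apply: aeW => t t0; exact: tail_trunc_cvg.
(* The truncated tail is finite, so [fine] loses nothing and [f^p] is that tail. *)
move=> n; pose f t := (fine (tail (trunc n h) t) `^ p^-1)%R.
have fE t : halfline t -> (f t `^ p)%:E = tail (trunc n h) t.
  move=> t0; rewrite /f -powRrM mulVf ?gt_eqF// powRr1 ?fineK//.
  - exact: tail_trunc_fin_num.
  - by rewrite fine_ge0// tail_ge0//; exact: halflineP.
have f0 : {in halfline, forall t, (0 <= f t)%R} by move=> t _; exact: powR_ge0.
have /hc hf : nonneg_measurable f.
  split => //.
  have mfine := measurableT_comp (@fine_measurable R _ measurableT)
    (measurable_tail _ (hn n)).
  exact: (measurableT_comp (@measurable_powR R p^-1) mfine).
have {}hf : monotone_ineq p u v w c f.
  apply: hf => s t; rewrite !inE => s0 t0 st; rewrite ge0_ler_powR ?nnegrE//.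
  - by rewrite invr_ge0 ltW.
  - by rewrite fine_ge0// tail_ge0//; exact: halflineP.
  - by rewrite fine_ge0// tail_ge0//; exact: halflineP.
  apply: fine_le; rewrite ?tail_trunc_fin_num//.
  apply: ge0_subset_integral => //.
  - by apply/measurable_EFinP/measurable_funTS; exact: measurable_trunc.
  - by move=> r _; rewrite lee_fin trunc_ge0.
  - by move=> r /=; rewrite !in_itv/= !andbT; exact: le_lt_trans.
move/monotone_ineqE : hf => /(_ p0 f0) hf.
have {}hf : hardy_le p u w (tail (trunc n h))
    (c%:E * (\int[mu]_(x in halfline) (f x `^ p * v x)%:E) `^ p^-1).
  move: hf; apply: ae_halfline_sub => x x0; rewrite (_ : \int[mu]_(t in `]0%R, x[) _ =
    \int[mu]_(t in `]0%R, x[) (tail (trunc n h) t `^ p^-1 * (u t)%:E)); last first.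
    apply: eq_integral => t; rewrite inE => /subset_itvoo_halfline t0.
    by rewrite fE.
  exact.
(* Truncated tails lie below [tail h], so the right-hand side can be enlarged to one free of [n]. *)
apply: hardy_leW hf; apply: lee_wpmul2l; first by rewrite lee_fin.
rewrite (_ : \int[mu]_(x in halfline) _ =
    \int[mu]_(t in halfline) (tail (trunc n h) t * (v t)%:E)); last first.
  by apply: eq_integral => t; rewrite inE => t0; rewrite EFinM fE.
apply: gt0_ler_poweR; first by rewrite invr_ge0 ltW.
- by rewrite in_itv/= integral_tail_ge0// leey.
- by rewrite in_itv/= integral_tail_ge0// leey.
apply: le_integral_weight => //.
- exact: measurable_tail.
- exact: measurable_tail.
- by move=> t /halflineP; exact: tail_ge0.
- move=> t t0; apply: ge0_le_integral => //.
  + by move=> s _; rewrite lee_fin trunc_ge0.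
  + by apply/measurable_EFinP/measurable_funTS; exact: measurable_trunc.
  + apply/measurable_EFinP.
    exact: (measurable_funS measurable_halfline (itvoy_halfline _ t0) hh.1).
  + move=> s ts; rewrite lee_fin; apply: trunc_le => //.
    exact: itvoy_halfline ts.
Qed.

Lemma reduced_to_monotone (p C : R) (u v w : R -> R) : (0 < p)%R ->
  weight u -> weight v -> weight w ->
  {in halfline, forall t, 0 < primitive u t} ->
  reduced_constants p u v w C -> monotone_constants p u v w (C `^ p^-1)%R.
Proof.
move=> p0 wu wv ww U0 [C0 hC]; split=> [|f hf nif]; first exact: powR_ge0.
have nv := weight_nonneg_measurable _ wv; have [_ v0] := nv.
apply/monotone_ineqE => //; first by case: hf.
pose phi t := (f t `^ p)%R.
have hphi : nonneg_measurable phi.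
  split; last by move=> t _; exact: powR_ge0.
  exact: (measurableT_comp (@measurable_powR R p) hf.1).
have niphi : nonincreasing_on_halfline phi.
  move=> s t s0 t0 st; rewrite ge0_ler_powR ?nnegrE ?(ltW p0)//.
  - by case: hf => _; apply.
  - by case: hf => _; apply.
  - exact: nif.
set I := \int[mu]_(x in halfline) (f x `^ p * v x)%:E.
have IE : I = \int[mu]_(t in halfline) ((phi t)%:E * (v t)%:E).
  by apply: eq_integral => t _; rewrite -EFinM.
have I0 : 0 <= I.
  apply: integral_ge0 => t t0; rewrite lee_fin mulr_ge0 ?powR_ge0 ?v0//.
  by rewrite inE.
have mphi : measurable_fun halfline (EFin \o phi).
  by apply/measurable_EFinP; case: hphi.
have -> : (C `^ p^-1)%:E * I `^ p^-1 = (C%:E * I) `^ p^-1.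
  by rewrite poweRM ?lee_fin.
(* Outer limit: truncations of [phi] increase to [phi]. *)
apply: (hardy_le_closed _ _ _ (fun n => EFin \o trunc n phi)) => //.
- by move=> n; apply/measurable_EFinP/measurable_funTS; exact: measurable_trunc.
- by move=> n t _; rewrite lee_fin trunc_ge0.
- apply: aeW => t t0; apply: cvg_EFin; first exact: nearW.
  exact: trunc_cvg.
move=> N; pose psi := trunc N phi.
have psi0 := trunc_ge0 N _ hphi; have ipsi := integrable_trunc N _ hphi.
have nipsi : nonincreasing_on_halfline psi.
  move=> s t; rewrite !inE => s0 t0 st; rewrite [leLHS]/psi /trunc patchE.
  (* If [t] lies in []0, N[], so does [s <= t], and minima with [N] are compared; otherwise
     [psi t = 0]. *)
  case: ifPn => [/[!inE]|_]; last exact: psi0.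
  rewrite /= in_itv/= => /andP[_ tN]; rewrite /psi /trunc patchE mem_set/=.
    by rewrite le_min !ge_min lexx orbT niphi ?inE.
  by rewrite in_itv/= halflineP//= (le_lt_trans st).
have hst n := nonneg_measurable_steep _ ipsi nipsi n.
(* Inner limit: [psi] is approximated almost everywhere by tails, to which (2) applies. *)
apply: (hardy_le_closed _ _ _ (fun n => tail (steep psi n))) => //.
- by move=> n; exact: measurable_tail.
- by move=> n t /halflineP; exact: tail_ge0.
- by apply/measurable_EFinP/measurable_funTS; exact: measurable_trunc.
- move: (tail_steep_cvg _ psi0 ipsi); apply: filterS.
    exact: (ae_filter_ringOfSetsType mu).
  by [].
move=> n; have /reduced_ineqE := hC _ (hst n) => /(_ p0 C0 wu wv ww (hst n)).
apply: hardy_leW; apply: gt0_ler_poweR; first by rewrite invr_ge0 ltW.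
- by rewrite in_itv/= leey andbT mule_ge0 ?lee_fin ?integral_tail_ge0.
- by rewrite in_itv/= leey andbT mule_ge0// lee_fin.
(* The chain [tail (steep psi n) <= psi <= phi] on the half-line gives a bound independent of [n]
   and [N]. *)
rewrite IE; apply: lee_wpmul2l; first by rewrite lee_fin.
apply: le_integral_weight => //.
- exact: measurable_tail.
- by move=> t /halflineP; exact: tail_ge0.
- move=> t t0; apply: le_trans (tail_steep_le _ psi0 ipsi nipsi n t t0) _.
  by rewrite lee_fin trunc_le.
Qed.

(** * Comparison of best constants *)

Lemma best_constant_ge0 (A : set R) : (forall c, A c -> (0 <= c)%R) ->
  0 <= best_constant A.
Proof.
by move=> A0; apply: le_ereal_inf_tmp => _ [c /A0 c0 <-]; rewrite lee_fin.
Qed.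

(** Each [c] in [B] puts [c^(1/q)] in [A], so [c] dominates the [q]-th power of the infimum of [A].
    An empty [B] has infimum [+oo], so no case is lost. *)
Lemma best_constant_poweR_le (q : R) (A B : set R) : (0 < q)%R ->
  (forall c, A c -> (0 <= c)%R) -> (forall c, B c -> (0 <= c)%R) ->
  (forall c, B c -> A (c `^ q^-1)%R) ->
  best_constant A `^ q <= best_constant B.
Proof.
move=> q0 A0 B0 BA; apply: le_ereal_inf_tmp => _ [c Bc <-].
rewrite lee_poweR_inv ?best_constant_ge0 ?lee_fin ?B0//.
by apply: ereal_inf_lbound; exists (c `^ q^-1)%R => //; exact: BA.
Qed.

End equivalence.

Theorem theorem5p2 (R : realType) (p : R) (p_gt0 : (0 < p)%R) :
  exists2 lambda : R, (0 < lambda)%R &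
  forall u v w : R -> R, weight u -> weight v -> weight w ->
  {in halfline, forall t, 0 < primitive u t} ->
  ((exists c, monotone_constants p u v w c) <->
   (exists C, reduced_constants p u v w C)) /\
  (lambda^-1%:E * best_constant (monotone_constants p u v w) `^ p
     <= best_constant (reduced_constants p u v w)
   /\ best_constant (reduced_constants p u v w)
     <= lambda%:E * best_constant (monotone_constants p u v w) `^ p).
Proof.
exists 1%R => // u v w wu wv ww U0; rewrite invr1 !mul1e.
have mr c := monotone_to_reduced p c u v w p_gt0 wu wv ww U0.
have rm C := reduced_to_monotone p C u v w p_gt0 wu wv ww U0.
have M0 c : monotone_constants p u v w c -> (0 <= c)%R by case.
have R0 C : reduced_constants p u v w C -> (0 <= C)%R by case.
split; first by split => [[c /mr]|[C /rm]]; [exists (c `^ p)%R|exists (C `^ p^-1)%R].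
split; first exact: best_constant_poweR_le.
(* The reverse bound is the same comparison with the two sets exchanged and exponent [1/p]. *)
rewrite -{3}(invrK p) -lee_poweR_inv ?invr_gt0 ?best_constant_ge0//.
by apply: best_constant_poweR_le; rewrite ?invrK ?invr_gt0.
Qed.
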